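(* Let $\alpha\in\mathbb{R}$, let $1\le K_b\le K<N$, and let $\Psi$ be a sampling operator selecting $K$ points. Perfect reconstruction of every $\alpha$-bandlimited point cloud signal $f\in\operatorname{BL}_{K_b}(F_M^{(\alpha)})$ from its $K$ samples $\Psi f$ is achievable (i.e. there is an interpolation operator $\Phi\in\mathbb{C}^{N\times K}$ with $f=\Phi\Psi f$ for all $f\in\operatorname{BL}_{K_b}(F_M^{(\alpha)})$) if and only if $$\operatorname{rank}\bigl(\Psi\mathcal{V}_{K_b}^{(\alpha)}\bigr)=K_b .$$ In this case, perfect recovery $f=\Phi\Psi f$ holds by choosing $\Phi=\mathcal{V}_{K_b}^{(\alpha)}U$, where $U\in\mathbb{C}^{K_b\times K}$ is a left inverse satisfying $U\Psi\mathcal{V}_{K_b}^{(\alpha)}=I_{K_b\times K_b}$.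
   Context: Discrete Laplace–Beltrami data. Let $P=\{p_1,\dots,p_N\}\subset\mathbb{R}^3$ be a point cloud sampled from a surface and let $t>0$. For each $i$, let $\hat T_{p_i}$ be the estimated tangent plane at $p_i$ (best-fitting plane to the points of $P$ in a ball around $p_i$), and let $b_{ii}>0$ be the area of the Voronoi cell of $p_i$ in the planar Voronoi diagram, on $\hat T_{p_i}$, of the projections of the points of $P$ in a ball $B(p_i,\delta)$. Let $B=\mathrm{diag}(b_{11},\dots,b_{NN})$ (mass matrix) and let $Q$ be the real symmetric matrix with $q_{ij}=\frac{b_{ii}b_{jj}}{4\pi t^2}\exp(-\|p_i-p_j\|^2/(4t))$ for $i\ne j$ and $q_{ii}=-\sum_{j\neq i}q_{ij}$. Let $H\in\mathbb{R}^{N\times N}$ be a matrix whose columns $H_i$ are generalized eigenvectors, $QH_i=-\lambda_i BH_i$, normalized so that $H^\top BH=I$. Fractional transform. Put $F_M:=H^\top B^{1/2}$, a real orthogonal matrix. Fix a spectral decomposition $F_M=V\Omega V^*$ with $V$ unitary and $\Omega=\mathrm{diag}(\omega_1,\dots,\omega_N)$, $|\omega_i|=1$. For $\alpha\in\mathbb{R}$ put $F_M^{(\alpha)}:=V\Omega^\alpha V^*$ with $\Omega^\alpha=\mathrm{diag}(\omega_1^\alpha,\dots,\omega_N^\alpha)$, where $\omega_i^\alpha:=e^{\mathrm{i}\alpha\theta_i}$ for a choice of real argument $\theta_i$ of $\omega_i$ fixed once for all $\alpha$. The point cloud manifold fractional harmonic transform (PMFHT) of order $\alpha$ of a signal $f\in\mathbb{C}^{N\times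 3}$ is $\hat f^{(\alpha)}:=F_M^{(\alpha)}B^{1/2}f$, whose rows are indexed $\hat f^{(\alpha)}(k)$, $k=0,\dots,N-1$; the inverse is $f=B^{-1/2}F_M^{(-\alpha)}\hat f^{(\alpha)}$. Sampling. A set of $K$ sampled point indices $\mathcal{K}=\{\mathcal{K}_0,\dots,\mathcal{K}_{K-1}\}$ (distinct) determines the sampling operator $\Psi\in\mathbb{R}^{K\times N}$, $\Psi_{i,j}=1$ if $j=\mathcal{K}_i$ and $0$ otherwise; the samples of $f$ are $\Psi f$. An interpolation operator is an $N\times K$ matrix $\Phi$, giving $f'=\Phi\Psi f$. Bandlimited signals. $\operatorname{BL}_{K_b}(F_M^{(\alpha)})$ is the set of signals $f\in\mathbb{C}^{N\times 3}$ with $\hat f^{(\alpha)}(k)=\mathbf{0}$ for all $k\ge K_b$. The bandlimited manifold basis matrix is $\mathcal{V}_{K_b}^{(\alpha)}:=B^{-1/2}(F_M^{(-\alpha)})_{(K_b)}\in\mathbb{C}^{N\times K_b}$, where $(F_M^{(-\alpha)})_{(K_b)}$ consists of the first $K_b$ columns of $F_M^{(-\alpha)}$. *)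

(* Defs.v *)
From mathcomp Require Import all_boot all_order all_algebra.
From mathcomp Require Import spectral complex.
From mathcomp Require Import all_classical all_reals all_analysis.

Set Implicit Arguments.
Unset Strict Implicit.
Unset Printing Implicit Defensive.

Import Order.TTheory GRing.Theory Num.Theory.

Local Open Scope ring_scope.
Local Open Scope complex_scope.
Local Open Scope sesquilinear_scope.

(* The norm and balls that the library puts on row vectors are those of the
   sup norm, hence this Euclidean norm. *)
Definition enorm (R : realType) (n : nat) (v : 'rV[R]_n) : R :=
  Num.sqrt (\sum_(k < n) v 0 k ^+ 2).

(* An affine plane of R^3 together with a Cartesian coordinate system on it:
   an origin and an orthonormal pair of directions (the rows of the frame). *)
Record plane (R : realType) := Plane {
  origin : 'rV[R]_3;
  frame : 'M[R]_(2, 3);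
  frame_orthonormal : frame *m frame^T = 1%:M }.

Definition plane_point (R : realType) (T : plane R) (u : R * R) : 'rV[R]_3 :=
  origin T + u.1 *: row 0 (frame T) + u.2 *: row 1 (frame T).

Definition plane_proj (R : realType) (T : plane R) (x : 'rV[R]_3) : 'rV[R]_3 :=
  origin T + (x - origin T) *m (frame T)^T *m frame T.

(* Sum of the squared distances to T of the cloud points in the open ball of
   radius rho around p i. *)
Definition fit_error (R : realType) (N : nat) (p : 'I_N -> 'rV[R]_3)
    (rho : R) (i : 'I_N) (T : plane R) : R :=
  \sum_(j < N | enorm (p j - p i) < rho) enorm (p j - plane_proj T (p j)) ^+ 2.

Definition best_fitting_plane (R : realType) (N : nat) (p : 'I_N -> 'rV[R]_3)
    (rho : R) (i : 'I_N) (T : plane R) : Prop :=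
  forall T' : plane R, fit_error p rho i T <= fit_error p rho i T'.

Definition voronoi_cell (R : realType) (N : nat) (p : 'I_N -> 'rV[R]_3)
    (delta : R) (i : 'I_N) (T : plane R) : set 'rV[R]_3 :=
  [set x | (exists u : R * R, x = plane_point T u) /\
    forall j : 'I_N, enorm (p j - p i) < delta ->
      enorm (x - plane_proj T (p i)) <= enorm (x - plane_proj T (p j))]%classic.

(* Area is planar Lebesgue measure in the Cartesian coordinates of T. *)
Definition plane_area (R : realType) (T : plane R) (A : set 'rV[R]_3) : \bar R :=
  (lebesgue_measure \x lebesgue_measure)%E (plane_point T @^-1` A)%classic.

Definition mass_mx (R : realType) (N : nat) (b : 'I_N -> R) : 'M[R]_N :=
  diag_mx (\row_i b i).

Definition mass_sqrt (R : realType) (N : nat) (b : 'I_N -> R) : 'M[R]_N :=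
  diag_mx (\row_i Num.sqrt (b i)).

Definition mass_invsqrt (R : realType) (N : nat) (b : 'I_N -> R) : 'M[R]_N :=
  diag_mx (\row_i (Num.sqrt (b i))^-1).

Definition heat_weight (R : realType) (N : nat) (p : 'I_N -> 'rV[R]_3) (t : R)
    (b : 'I_N -> R) (i j : 'I_N) : R :=
  b i * b j / (4 * pi * t ^+ 2) * expR (- (enorm (p i - p j) ^+ 2 / (4 * t))).

Definition stiffness_mx (R : realType) (N : nat) (p : 'I_N -> 'rV[R]_3) (t : R)
    (b : 'I_N -> R) : 'M[R]_N :=
  \matrix_(i, j) if i == j then - \sum_(k < N | k != i) heat_weight p t b i k
                 else heat_weight p t b i j.

Definition harmonic_mx (R : realType) (N : nat) (b : 'I_N -> R) (H : 'M[R]_N) :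
    'M[R]_N :=
  H^T *m mass_sqrt b.

Definition complex_mx (R : realType) (m n : nat) (A : 'M[R]_(m, n)) :
    'M[R[i]]_(m, n) :=
  map_mx (real_complex R) A.

(* e^(i x) for real x *)
Definition expi (R : realType) (x : R) : R[i] := cos x +i* sin x.

Definition spectral_decomposition (R : realType) (N : nat) (F : 'M[R[i]]_N)
    (V : 'M[R[i]]_N) (omega : 'I_N -> R[i]) : Prop :=
  [/\ V \is unitarymx, (forall i, `|omega i| = 1) &
      F = V *m diag_mx (\row_i omega i) *m V^t*].

(* The transform of order alpha attached to a spectral decomposition with
   eigenvector matrix V and eigenvalues e^(i theta_k): the arguments theta_k
   fix the branch of every power. *)
Definition frac_mx (R : realType) (N : nat) (V : 'M[R[i]]_N) (theta : 'I_N -> R)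
    (alpha : R) : 'M[R[i]]_N :=
  V *m diag_mx (\row_k expi (alpha * theta k)) *m V^t*.

Definition pmfht (R : realType) (N : nat) (b : 'I_N -> R) (V : 'M[R[i]]_N)
    (theta : 'I_N -> R) (alpha : R) (f : 'M[R[i]]_(N, 3)) : 'M[R[i]]_(N, 3) :=
  frac_mx V theta alpha *m complex_mx (mass_sqrt b) *m f.

Definition bandlimited (R : realType) (N : nat) (b : 'I_N -> R)
    (V : 'M[R[i]]_N) (theta : 'I_N -> R) (alpha : R) (Kb : nat) :
    set 'M[R[i]]_(N, 3) :=
  [set f | forall k : 'I_N, (Kb <= k)%N ->
             row k (pmfht b V theta alpha f) = 0]%classic.

Definition bandlimited_basis (R : realType) (N : nat) (b : 'I_N -> R)
    (V : 'M[R[i]]_N) (theta : 'I_N -> R) (alpha : R) (Kb : nat)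
    (KbN : (Kb <= N)%N) : 'M[R[i]]_(N, Kb) :=
  complex_mx (mass_invsqrt b) *m
    colsub (widen_ord KbN) (frac_mx V theta (- alpha)).

Definition sampling_mx (R : realType) (N K : nat) (kappa : 'I_K -> 'I_N) :
    'M[R[i]]_(K, N) :=
  \matrix_(i, j) (j == kappa i)%:R.

(* Main.v *)
Require Import Defs.
From mathcomp Require Import all_boot all_order all_algebra.
From mathcomp Require Import spectral complex.
From mathcomp Require Import all_classical all_reals all_analysis.
Import Order.TTheory GRing.Theory Num.Theory.
Local Open Scope ring_scope.
Local Open Scope complex_scope.
Local Open Scope sesquilinear_scope.

(** Let A = F^(alpha) B^(1/2) be the matrix of the transform of order alpha,
    and let E = B^(-1/2) F^(-alpha).  Since V is unitary, the powers
    F^(alpha) and F^(-alpha) are mutually inverse, and so are A and E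
    ([mul_pmfht_mx]).  A signal f equals E (A f), so it is
    bandlimited exactly when it is a combination of the first Kb columns of E:
    the bandlimited signals are the V_Kb g, with g an arbitrary matrix of
    Kb spectral coefficients ([head_supported_iff_span]).  Moreover V_Kb has a
    left inverse, namely the first Kb rows of A.

    What remains is linear algebra about a matrix W with a left inverse L and
    a sampling matrix S ([recoverable_span_iff_rank]).  If Phi recovers every
    W g from S W g, then Phi S W = W, so L Phi is a left inverse of S W, which
    therefore has full column rank.  Conversely a matrix of full column rank
    has a left inverse U, and any such U gives W U S (W g) = W g. *)

Lemma span_recovery {F : fieldType} {n m k c : nat} (W : 'M[F]_(n, m))
    (S : 'M[F]_(k, n)) (U : 'M[F]_(m, k)) (g : 'M[F]_(m, c)) :
  U *m (S *m W) = 1%:M -> (W *m U) *m (S *m (W *m g)) = W *m g.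
Proof.
by move=> USW; rewrite (mulmxA S) -(mulmxA W) (mulmxA U) USW mul1mx.
Qed.

Lemma left_inverse_iff_rank {F : fieldType} {m k : nat} (X : 'M[F]_(k, m)) :
  (exists U : 'M[F]_(m, k), U *m X = 1%:M) <-> \rank X = m.
Proof.
by split=> [/row_fullP/eqP | rX] //; apply/row_fullP/eqP.
Qed.

(** Having at least one signal channel (c > 0) is what turns a family of
    identities Phi S W g = W g into the matrix identity Phi S W = W: a basis
    vector can be placed in one channel. *)
Lemma mulmx_inj_channels {F : fieldType} {n m c : nat} (X Y : 'M[F]_(n, m)) :
  (0 < c)%N -> (forall g : 'M[F]_(m, c), X *m g = Y *m g) -> X = Y.
Proof.
case: c => // c _ eqXY; apply: trmx_inj; apply/row_matrixP=> j.
rewrite -!tr_col; congr (_^T).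
by rewrite !colE -(mul_delta_mx (0 : 'I_c.+1)) !mulmxA eqXY.
Qed.

Lemma recoverable_span_iff_rank {F : fieldType} {n m k c : nat}
    (W : 'M[F]_(n, m)) (L : 'M[F]_(m, n)) (S : 'M[F]_(k, n)) :
  (0 < c)%N -> L *m W = 1%:M ->
  (exists Phi : 'M[F]_(n, k),
     forall g : 'M[F]_(m, c), W *m g = Phi *m (S *m (W *m g))) <->
  \rank (S *m W) = m.
Proof.
move=> c_gt0 LW; rewrite -left_inverse_iff_rank; split=> [[Phi recPhi]|[U USW]].
  exists (L *m Phi); rewrite -mulmxA -[RHS]LW; congr (_ *m _).
  apply: (mulmx_inj_channels _ _ c_gt0) => g.
  by rewrite [RHS]recPhi !mulmxA.
by exists (W *m U) => g; rewrite span_recovery.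
Qed.

Section Truncation.
Context {F : fieldType} {n m : nat} (mn : (m <= n)%N).
Variables A E : 'M[F]_n.
Hypothesis AE : A *m E = 1%:M.

Lemma head_rows_left_inverse :
  rowsub (widen_ord mn) A *m colsub (widen_ord mn) E = 1%:M.
Proof.
rewrite -mxsub_mul AE; apply/matrixP=> i j.
by rewrite !mxE.
Qed.

(** Writing f = E (A f), the columns of E beyond the first m meet only
    vanishing rows of A f. *)
Lemma head_supported_iff_span {c : nat} (f : 'M[F]_(n, c)) :
  (forall k : 'I_n, (m <= k)%N -> row k (A *m f) = 0) <->
  exists g : 'M[F]_(m, c), f = colsub (widen_ord mn) E *m g.
Proof.
split=> [supp|[g ->] k mk]; last first.
  rewrite mulmxA mulmx_colsub AE; apply/rowP=> j; rewrite !mxE big1 // => l _.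
  rewrite !mxE; case: eqP => [kl|_]; last by rewrite mul0r.
  by move: mk; rewrite kl /= leqNgt ltn_ord.
exists (rowsub (widen_ord mn) (A *m f)).
rewrite -[LHS]mul1mx -(mulmx1C AE) -mulmxA; apply/matrixP=> i j.
rewrite !mxE (bigID (fun k : 'I_n => (k < m)%N)) /= [X in _ + X]big1 ?addr0.
  rewrite (big_ord_narrow mn); apply: eq_bigr => k _.
  by rewrite [in RHS]mxE [X in _ = _ * X]mxE.
move=> k; rewrite -leqNgt => /supp/rowP/(_ j).
by rewrite [LHS]mxE [RHS]mxE => ->; rewrite mulr0.
Qed.

End Truncation.

Lemma expi_mulN {R : realType} (x : R) : expi x * expi (- x) = 1.
Proof.
apply/eqP; rewrite eq_complex /= cosN sinN mulrN opprK -!expr2 cos2Dsin2 eqxx /=.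
by rewrite mulrN mulrC addNr.
Qed.

Lemma frac_mx_mulN {R : realType} {N : nat} (V : 'M[R[i]]_N) (theta : 'I_N -> R)
    (alpha : R) :
  V \is unitarymx -> frac_mx V theta alpha *m frac_mx V theta (- alpha) = 1%:M.
Proof.
move=> uV; have VV : V^t* *m V = 1%:M by apply/mulmx1C/unitarymxP.
rewrite /frac_mx -!mulmxA (mulmxA (V^t*)) VV mul1mx (mulmxA (diag_mx _)).
rewrite mulmx_diag.
suff -> : diag_mx (\row_i ((\row_k expi (alpha * theta k)) 0 i *
     (\row_k expi (- alpha * theta k)) 0 i)) = 1%:M :> 'M[R[i]]_N.
  by rewrite mul1mx; apply/unitarymxP.
rewrite -diag_const_mx; congr diag_mx; apply/rowP=> k.
by rewrite !mxE mulNr expi_mulN.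
Qed.

Lemma mass_sqrtK {R : realType} {N : nat} (b : 'I_N -> R) :
  (forall i, 0 < b i) ->
  complex_mx (mass_sqrt b) *m complex_mx (mass_invsqrt b) = 1%:M.
Proof.
move=> b_gt0; rewrite -map_mxM mulmx_diag -[RHS](map_mx1 (real_complex R)).
congr map_mx; rewrite -diag_const_mx; congr diag_mx; apply/rowP=> k.
by rewrite !mxE divff // gt_eqF // sqrtr_gt0.
Qed.

(** Matrix form of the inversion formula for the transform: analysis undoes
    synthesis. Both matrices being square, this is also the other order. *)
Lemma mul_pmfht_mx {R : realType} {N : nat} (b : 'I_N -> R) (V : 'M[R[i]]_N)
    (theta : 'I_N -> R) (alpha : R) :
  (forall i, 0 < b i) -> V \is unitarymx ->
  (frac_mx V theta alpha *m complex_mx (mass_sqrt b)) *m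
  (complex_mx (mass_invsqrt b) *m frac_mx V theta (- alpha)) = 1%:M.
Proof.
move=> b_gt0 uV.
by rewrite -mulmxA (mulmxA (complex_mx _)) mass_sqrtK // mul1mx frac_mx_mulN.
Qed.

Theorem theorem6 (R : realType) (N : nat)
    (p : 'I_N -> 'rV[R]_3) (p_inj : injective p)
    (t : R) (t_gt0 : 0 < t)
    (rho : 'I_N -> R) (rho_gt0 : forall i, 0 < rho i)
    (delta : R) (delta_gt0 : 0 < delta)
    (T : 'I_N -> plane R)
    (T_fit : forall i, best_fitting_plane p (rho i) i (T i))
    (b : 'I_N -> R) (b_gt0 : forall i, 0 < b i)
    (b_area : forall i,
        plane_area (T i) (voronoi_cell p delta i (T i)) = (b i)%:E)
    (H : 'M[R]_N) (lambda : 'I_N -> R)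
    (H_eigen : forall i, stiffness_mx p t b *m col i H =
                         - lambda i *: (mass_mx b *m col i H))
    (H_orthonormal : H^T *m mass_mx b *m H = 1%:M)
    (V : 'M[R[i]]_N) (omega : 'I_N -> R[i])
    (F_spectral :
        spectral_decomposition (complex_mx (harmonic_mx b H)) V omega)
    (theta : 'I_N -> R) (theta_arg : forall i, omega i = expi (theta i))
    (alpha : R) (Kb K : nat)
    (Kb_gt0 : (1 <= Kb)%N) (KbK : (Kb <= K)%N) (KN : (K < N)%N)
    (kappa : 'I_K -> 'I_N) (kappa_inj : injective kappa) :
  let BL := bandlimited b V theta alpha Kb in
  let VKb := bandlimited_basis b V theta alpha (leq_trans KbK (ltnW KN)) in
  let Psi := sampling_mx R kappa in
  ((exists Phi : 'M[R[i]]_(N, K),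
      forall f : 'M[R[i]]_(N, 3), BL f -> f = Phi *m (Psi *m f)) <->
   \rank (Psi *m VKb) = Kb) /\
  (\rank (Psi *m VKb) = Kb ->
     (exists U : 'M[R[i]]_(Kb, K), U *m (Psi *m VKb) = 1%:M) /\
     (forall U : 'M[R[i]]_(Kb, K), U *m (Psi *m VKb) = 1%:M ->
        forall f : 'M[R[i]]_(N, 3), BL f -> f = (VKb *m U) *m (Psi *m f))).
Proof.
move=> BL VKb Psi.
case: F_spectral => uV _ _.
have AE := mul_pmfht_mx b V theta alpha b_gt0 uV.
have LW := head_rows_left_inverse (leq_trans KbK (ltnW KN)) _ _ AE.
have BLE f : BL f <-> exists g : 'M[R[i]]_(Kb, 3), f = VKb *m g.
  rewrite /VKb /bandlimited_basis mulmx_colsub.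
  exact: (head_supported_iff_span _ _ _ AE).
rewrite -mulmx_colsub -/VKb in LW.
split; last first.
  move=> rk; split; first exact/left_inverse_iff_rank.
  by move=> U USW f /BLE[g ->]; rewrite span_recovery.
rewrite -(recoverable_span_iff_rank (c := 3) _ _ _ isT LW).
split=> -[Phi recPhi]; exists Phi.
  by move=> g; apply: recPhi; apply/BLE; exists g.
by move=> f /BLE[g ->].
Qed.
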